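(* Let $r\ge2$, let $\bm{\nu}=(\mu_1,\dots,\mu_{r-1})\in\mathcal{L}^{r-1}$ with $\mu_j\in\mathcal{L}_{N_j}$, $\bm{K}=(N_1,\dots,N_{r-1})$, and suppose that $\bm{\nu}$ and $\widehat{\bm{\nu}}=(x-z_0)\bm{\nu}$ are perfect for some $z_0\in\mathbb{R}$. Let $1\le j\le r-1$ and $\bm{k}\in\mathbb{N}^{r-1}_{\bm{K}-\bm{e}_j}$. If $P_{\bm{k}+\bm{e}_j}(x)\sim P_{\bm{k}}(x)$, then $\widehat P_{\bm{k}}$ is real-rooted. Moreover, $$(x-z_0)\widehat P_{\bm{k}}(x)\sim P_{\bm{k}}(x)\qquad\text{and}\qquad(x-z_0)\widehat P_{\bm{k}}(x)\sim P_{\bm{k}+\bm{e}_j}(x).$$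
   Context: For nonzero real polynomials, $p\sim q$ (the zeros interlace) means: all zeros of $p$ and $q$ are pairwise distinct, real and simple, and between every two consecutive zeros of one of the polynomials there lies exactly one zero of the other. A polynomial is real-rooted if all its zeros are real. $\mathbb{N}=\{0,1,2,\dots\}$; $\bm{e}_j$ are the standard unit vectors; $\mathbb{N}^s_{\bm{M}}=\{\bm{n}\in\mathbb{N}^s:n_j\le M_j\ \forall j\}$. A moment functional is a linear map $\mu:\mathbb{C}[x]\to\mathbb{C}$; put $\Delta_n=\det(\mu[x^{i+k}])_{i,k=0}^{n-1}$. For $N\in\{1,2,\dots\}$, $\mathcal{L}_N$ is the set of $\mu$ with $\Delta_n\ne0$ for $1\le n\le N$ and $\Delta_n=0$ for $n>N$; $\mathcal{L}_\infty$ is the set of $\mu$ with $\Delta_n\neq0$ for all $n$; $\mathcal{L}=\mathcal{L}_\infty\cup\bigcup_{N\ge1}\mathcal{L}_N$. $(x-z_0)\bm{\nu}$ is the system of functionals $f\mapsto\mu_j[(x-z_0)f]$. For a system $(\mu_1,\dots,\mu_s)$ and $\bm{n}\in\mathbb{N}^s$, $|\bm{n}|=\sum n_j$, the index $\bm{n}$ is normal if every nonzero polynomial $P$ with $\deg P\le|\bm{n}|$ and $\mu_j[P(x)x^p]=0$ for $0\le p\le n_j-1$, $1\le j\le s$, has degree exactly $|\bm{n}|$; then there is a unique monic such polynomial (the type II multiple orthogonal polynomial), denoted $P_{\bm{n}}$ for $\bm{\nu}$ and $\widehat P_{\bm{n}}$ for $\widehat{\bm{\nu}}$. $\bm{\nu}$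 and $\widehat{\bm{\nu}}$ are called perfect if all indices in $\mathbb{N}^{r-1}_{\bm{K}}$ are normal for them. *)

(* Defs.v *)
From HB Require Import structures.
From mathcomp Require Import all_boot all_order all_algebra.
From mathcomp Require Import boolp classical_sets reals.
From mathcomp Require Import complex.

Set Implicit Arguments.
Unset Strict Implicit.
Unset Printing Implicit Defensive.

Import Order.TTheory GRing.Theory Num.Theory.
Local Open Scope ring_scope.
Local Open Scope complex_scope.

(* Elements of {0, 1, 2, ...} U {oo} are encoded in [option nat], with [None]
   standing for oo. *)

Definition multi_index (s : nat) := 'I_s -> nat.

Definition mi_size s (n : multi_index s) : nat := (\sum_(i < s) n i)%N.

Definition mi_succ s (n : multi_index s) (j : 'I_s) : multi_index s :=
  fun i => (n i + (i == j))%N.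

Definition in_box s (M : 'I_s -> option nat) (n : multi_index s) : Prop :=
  forall i, if M i is Some m then (n i <= m)%N else true.

(* M - e_j, with oo - 1 = oo. The truncation of [predn] at 0 is harmless: every
   component of K is at least 1 by [in_calL]. *)
Definition box_pred s (M : 'I_s -> option nat) (j : 'I_s) : 'I_s -> option nat :=
  fun i => if i == j then omap predn (M i) else M i.

Definition functional (R : realType) := {scalar {poly R[i]}}.

Section Functional.
Variable R : realType.
Implicit Types (mu : functional R) (p : {poly R[i]}).

Definition hankel mu (n : nat) : R[i] :=
  \det (\matrix_(i < n, k < n) mu 'X^(i + k)).

Definition in_calL (N : option nat) mu : Prop :=
  if N is Some m then
    [/\ (1 <= m)%N,
        forall n, (1 <= n <= m)%N -> hankel mu n != 0
      & forall n, (m < n)%N -> hankel mu n = 0]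
  else forall n, hankel mu n != 0.

(* The functional (x - z0) mu. *)
Definition christoffel_fun (z0 : R) mu : {poly R[i]} -> R[i] :=
  fun f => mu (('X - z0%:C%:P) * f).

Lemma christoffel_is_linear z0 mu :
  linear_for *%R (christoffel_fun z0 mu).
Proof.
by move=> a f g; rewrite /christoffel_fun mulrDr -scalerAr linearP.
Qed.

HB.instance Definition _ z0 mu :=
  GRing.isLinear.Build _ _ _ _ (christoffel_fun z0 mu)
    (christoffel_is_linear z0 mu).

Definition christoffel (z0 : R) mu : functional R := christoffel_fun z0 mu.

End Functional.

Section MultipleOrthogonality.
Variables (R : realType) (s : nat).
Implicit Types (nu : 'I_s -> functional R) (n : multi_index s).

Definition type_II_cond nu n (P : {poly R[i]}) : Prop :=
  (size P <= (mi_size n).+1)%N /\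
  forall (j : 'I_s) (p : nat), (p < n j)%N -> nu j (P * 'X^p) = 0.

Definition normal nu n : Prop :=
  forall P, P != 0 -> type_II_cond nu n P -> size P = (mi_size n).+1.

Definition perfect_on (M : 'I_s -> option nat) nu : Prop :=
  forall n, in_box M n -> normal nu n.

(* The monic polynomial P_n, chosen classically; it is meaningful (and equal to
   the only possible choice) when n is normal, see [mopP] and [mop_unique]. *)
Definition mop nu n : {poly R[i]} :=
  xget 0 [set P | P \is monic /\ type_II_cond nu n P]%classic.

Lemma type_II_cond_ex nu n : exists2 P, P != 0 & type_II_cond nu n P.
Proof.
pose T := {j : 'I_s & 'I_(n j)}.
have cT : #|{: T}| = mi_size n.
  rewrite card_tagged sumnE big_map big_enum /=.
  by apply: eq_bigr => i _; rewrite card_ord.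
pose A := \matrix_(i < (mi_size n).+1, t < #|{: T}|)
  nu (tag (enum_val t)) ('X^i * 'X^(tagged (enum_val t))).
have /rowV0Pn [v /sub_kermxP vA v0] : kermx A != 0.
  rewrite -mxrank_eq0 mxrank_ker subn_eq0 -ltnNge ltnS.
  exact: leq_trans (rank_leq_col A) (eq_leq cT).
exists (rVpoly v).
  by apply: contra v0 => /eqP v0; rewrite -[v]rVpolyK v0 linear0.
split=> [|j p lt_p]; first exact: size_poly.
have /rowP/(_ (enum_rank (Tagged (fun j => 'I_(n j)) (Ordinal lt_p)))) := vA.
rewrite !mxE => <-; rewrite /rVpoly poly_def mulr_suml linear_sum /=.
apply: eq_bigr => i _; rewrite valK -scalerAl linearZ /=.
by rewrite !mxE enum_rankK.
Qed.

Lemma mopP nu n : normal nu n ->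
  [/\ mop nu n \is monic, size (mop nu n) = (mi_size n).+1
    & type_II_cond nu n (mop nu n)].
Proof.
move=> nor; have [P P0 [sP oP]] := type_II_cond_ex nu n.
have l0 : lead_coef P != 0 by rewrite lead_coef_eq0.
have : exists Q, Q \is monic /\ type_II_cond nu n Q.
  exists ((lead_coef P)^-1 *: P); split.
    by rewrite monicE lead_coefZ mulVf.
  split=> [|j p lt_p]; first by rewrite size_scale ?invr_eq0.
  by rewrite -scalerAl linearZ /= oP // mulr0.
move=> /(xgetPex 0); rewrite -/(mop nu n) => -[mQ cQ].
by split=> //; apply: nor => //; apply: monic_neq0.
Qed.

Lemma mop_unique nu n P : normal nu n ->
  P \is monic -> type_II_cond nu n P -> P = mop nu n.
Proof.
move=> nor mP cP; have [mQ sQ cQ] := mopP nor.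
have sP : size P = (mi_size n).+1 by apply: nor => //; apply: monic_neq0.
apply/eqP; rewrite -subr_eq0; apply/negPn/negP => D0.
have ltD : (size (P - mop nu n)%R < (mi_size n).+1)%N.
  rewrite ltnS; apply/leq_sizeP => i; rewrite leq_eqVlt coefB => /orP[/eqP <-|lt_i].
    move: mP mQ; rewrite !monicE !lead_coefE sP sQ => /eqP -> /eqP ->.
    by rewrite subrr.
  by rewrite !nth_default ?subrr ?sP ?sQ.
suff e : size (P - mop nu n)%R = (mi_size n).+1 by rewrite e ltnn in ltD.
apply: nor => //; split=> [|j p lt_p]; first exact: ltnW.
by rewrite mulrBl linearB /= (cP.2 _ _ lt_p) (cQ.2 _ _ lt_p) subrr.
Qed.

End MultipleOrthogonality.

Section Interlacing.
Variable R : realType.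
Implicit Types p q : {poly R[i]}.

Definition real_rooted p : Prop := forall z, root p z -> z \is Num.real.

Definition consecutive_zeros p (a b : R[i]) : Prop :=
  [/\ a < b, root p a, root p b & forall c, a < c < b -> ~~ root p c].

Definition separates q p : Prop :=
  forall a b, consecutive_zeros p a b -> exists! c, (a < c < b) /\ root q c.

Definition real_poly p : Prop := forall i, p`_i \is Num.real.

(* p and q are taken in C[x], since the orthogonal polynomials a priori live
   there; [real_poly] says that they are in fact real polynomials. The order on
   R[i] used in [consecutive_zeros] restricts to the usual one on the reals. *)
Definition interlace p q : Prop :=
  [/\ [/\ p != 0, q != 0, real_poly p & real_poly q],
      real_rooted p /\ real_rooted q,
      (forall z, root p z -> mup z p = 1%N) /\
      (forall z, root q z -> mup z q = 1%N),
      forall z, ~~ (root p z && root q z)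
    & separates q p /\ separates p q].

End Interlacing.

(* Main.v *)
(* (x - z0) Phat_k is monic, of the degree of P = P_{k + e_j}, and satisfies the
   orthogonality conditions of index k; normality of k gives
   (x - z0) Phat_k = P + d Q with Q = P_k, and d <> 0 since P(z0) = 0 would
   contradict the normality of k + e_j for (x - z0) nu.
   As P ~ Q, the quotients w_a = Q(a) / P'(a) at the zeros a of P all have the
   same sign, and Lagrange interpolation Q = sum_a w_a P / (x - a) gives
   P' Q - P Q' = sum_a w_a (P / (x - a))^2, which has no real zero, and also the
   real-rootedness of P + d Q. Up to a nonzero factor, P' Q - P Q' is the
   Wronskian of P + d Q with either Q or P, and real-rooted polynomials whose
   Wronskian has no real zero interlace. *)
Require Import Defs.
From mathcomp Require Import all_boot all_order all_algebra.
From mathcomp Require Import reals.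
From mathcomp Require Import complex polyrcf.
From mathcomp Require Import ring lra.

Import Order.TTheory GRing.Theory Num.Theory.
Local Open Scope ring_scope.

Set Implicit Arguments.
Unset Strict Implicit.
Unset Printing Implicit Defensive.

(** * Derivatives at simple zeros and sign changes between zeros *)

Lemma deriv_mulXsubC (F : comNzRingType) (s : {poly F}) (a : F) :
  (s * ('X - a%:P))^`().[a] = s.[a].
Proof.
by rewrite derivM derivXsubC hornerD !hornerM hornerXsubC hornerC; ring.
Qed.

Lemma mup_deriv_eq1 (F : fieldType) (P : {poly F}) (z : F) : P != 0 ->
  root P z -> (mup z P == 1%N) = (P^`().[z] != 0).
Proof.
move=> P0 /factor_theorem [S eP]; move: P0;
  rewrite {}eP mulf_eq0 => /norP[S0 X0].
rewrite mupM // -['X - z%:P]expr1 mup_XsubCX eqxx addn1 eqSS expr1.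
by rewrite deriv_mulXsubC -leqn0 -ltnS mup_ltn // expr1 dvdp_XsubCl.
Qed.

Section Signs.
Variable R : rcfType.
Implicit Types (p q : {poly R}) (a b c : R).

Lemma gt0_horner_noroot p a b : a <= b ->
  (forall x, a <= x <= b -> ~~ root p x) -> 0 < p.[a] * p.[b].
Proof.
move=> ab nr; rewrite ltNge; apply/negP => /(polyrcf.poly_ivt ab) [x].
by rewrite in_itv /= => /nr /negbTE ->.
Qed.

(** With p = s (x - a)(x - b), the product of the two derivatives is - s(a) s(b) (b - a)^2, and [s]
    keeps its sign on [a, b]: the derivative hypotheses exclude zeros of [s] at the endpoints. *)
Lemma deriv_consecutive_roots p a b : a < b ->
  root p a -> root p b -> p^`().[a] != 0 -> p^`().[b] != 0 ->
  (forall x, a < x < b -> ~~ root p x) -> p^`().[a] * p^`().[b] < 0.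
Proof.
move=> ab ra /factor_theorem [s1 ep].
move: ra; rewrite {}ep rootM root_XsubC (lt_eqF ab) orbF =>
  /factor_theorem [s ->].
rewrite deriv_mulXsubC mulrAC deriv_mulXsubC !hornerM !hornerXsubC.
rewrite !mulf_eq0 !negb_or => /andP[sa _] /andP[sb _] nr.
have : 0 < s.[a] * s.[b].
  apply: gt0_horner_noroot => [|x]; first exact: ltW.
  rewrite !le_eqVlt => /andP[/predU1P[<- _|ax /predU1P[->|xb]]] //.
  by have := nr x; rewrite ax xb !rootM !negb_or => /(_ isT)/andP[/andP[]].
move=> sab; have : 0 < (b - a) ^+ 2 by rewrite exprn_gt0 ?subr_gt0.
move=> /(mulr_gt0 sab). nra.
Qed.

(** With q = s (x - c), simplicity of [c] makes s(c) nonzero, so [s] keeps its sign on [a, b] while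
    x - c changes sign. *)
Lemma lt0_horner_simple_root q a b c : a < c < b ->
  root q c -> q^`().[c] != 0 -> ~~ root q a -> ~~ root q b ->
  (forall x, a < x < b -> root q x -> x = c) -> q.[a] * q.[b] < 0.
Proof.
move=> /andP[ac cb] /factor_theorem [s ->].
rewrite deriv_mulXsubC !hornerM !hornerXsubC !rootM !negb_or =>
  sc /andP[sa _] /andP[sb _] uq.
have : 0 < s.[a] * s.[b].
  apply: gt0_horner_noroot => [|x]; first exact/ltW/(lt_trans ac).
  rewrite !le_eqVlt => /andP[/predU1P[<- _|ax /predU1P[->|xb]]] //.
  apply/negP => rx; have xc : x = c by apply: uq; rewrite ?ax ?rootM ?rx.
  by move: rx sc; rewrite xc rootE => ->.
have : 0 < (c - a) * (b - c) by rewrite mulr_gt0 ?subr_gt0.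
by move=> h /(mulr_gt0 h); nra.
Qed.

(** Induction on the number of points of [s] strictly between [a] and [b]: a point in between splits
    the interval into two with strictly fewer points. This reduces claims about arbitrary pairs of
    zeros to consecutive ones. *)
Lemma consecutive_chain (s : seq R) (T : R -> R -> Prop) :
  (forall a b c, T a b -> T b c -> T a c) ->
  (forall a b, a \in s -> b \in s -> a < b ->
     (forall c, c \in s -> ~~ (a < c < b)) -> T a b) ->
  forall a b, a \in s -> b \in s -> a < b -> T a b.
Proof.
move=> Ttr Tcons a b.
have lt_count (P1 P2 : pred R) c : subpred P1 P2 -> c \in s ->
    P2 c -> ~~ P1 c -> (count P1 s < count P2 s)%N.
  move=> sub cs P2c /negbTE P1c.
  rewrite !(permP (perm_to_rem cs)) /= P1c P2c add0n add1n ltnS.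
  exact: sub_count.
have [n] := ubnP (count (fun x => a < x < b) s).
elim: n a b => // n IHn a b; rewrite ltnS => len as_ bs ab.
have [/hasP[c cs /andP[ac cb]] | /hasPn nc] := boolP (has (fun x =>
  a < x < b) s).
  apply: (Ttr _ c); apply: IHn => //; apply: leq_trans len;
    apply: (lt_count _ _ c);
    rewrite //= ?ac ?cb ?ltxx ?andbF // => x /andP[ax xb].
  - by rewrite ax (lt_trans xb).
  - by rewrite xb (lt_trans ac).
exact: Tcons.
Qed.

(** * Wronskians, and Lagrange interpolation at the zeros *)

Definition wronskian p q := p^`() * q - p * q^`().

Lemma wronskianC p q : wronskian q p = - wronskian p q.
Proof. by rewrite /wronskian; ring. Qed.

Lemma wronskianDZ p q c : wronskian (p + c *: q) q = wronskian p q.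
Proof. by rewrite /wronskian derivD derivZ -!mul_polyC; ring. Qed.

(** At the zeros of [p] the Wronskian equals p' q. It keeps its sign, whereas p' changes sign
    between consecutive zeros; hence [q] changes sign too and vanishes in between. *)
Lemma wronskian_root_between p q a b : p != 0 ->
  (forall x, (wronskian p q).[x] != 0) ->
  a < b -> root p a -> root p b -> exists2 c, a < c < b & root q c.
Proof.
move=> p0 W ab ra rb.
have mem_roots x : (x \in rootsR p) = root p x.
  by rewrite -(roots_on_rootsR p0) in_itv.
have W_root x : root p x -> (wronskian p q).[x] = p^`().[x] * q.[x].
  by move=> /rootP px; rewrite /wronskian !hornerE px; ring.
apply: (consecutive_chain (s := rootsR p)
  (T := fun x y => exists2 c, x < c < y & root q c)) ab; rewrite ?mem_roots //.
  move=> x y z [c /andP[xc cy] rc] [e /andP[ye ez] _].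
  by exists c => //; rewrite xc (lt_trans cy) // (lt_trans ye).
move=> x y; rewrite !mem_roots => rx ry xy nr.
have d_neq0 t : root p t -> p^`().[t] != 0.
  by move=> rt; have := W t; rewrite W_root // mulf_eq0 => /norP[].
have dd : p^`().[x] * p^`().[y] < 0.
  apply: deriv_consecutive_roots => //; rewrite ?d_neq0 //.
  by move=> t t_in; apply: contraL t_in; rewrite -mem_roots => /nr.
have : 0 < (wronskian p q).[x] * (wronskian p q).[y].
  by apply: gt0_horner_noroot => [|t _]; [apply: ltW | apply: W].
rewrite !W_root // mulrACA nmulr_rgt0 // => qq.
have [c] := poly_ivtoo (ltW xy) qq; rewrite in_itv /=; by exists c.
Qed.

(** For duplicate-free [s] containing [a], this is the quotient p / (x - a) of the polynomial p with
    zero set [s], and its value at [a] is p'(a). *)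
Definition del_root (s : seq R) a : {poly R} :=
  \prod_(b <- s | b != a) ('X - b%:P).

Lemma del_rootE s a : uniq s -> a \in s ->
  \prod_(b <- s) ('X - b%:P) = ('X - a%:P) * del_root s a.
Proof. by move=> us as_; rewrite (bigD1_seq a). Qed.

Lemma root_del_root s a x : root (del_root s a) x = (x \in s) && (x != a).
Proof. by rewrite /del_root -big_filter root_prod_XsubC mem_filter andbC. Qed.

Lemma deriv_del_root s a : uniq s -> a \in s ->
  (\prod_(b <- s) ('X - b%:P))^`().[a] = (del_root s a).[a].
Proof.
move=> us as_; rewrite (del_rootE us as_) derivM derivXsubC !hornerE.
by rewrite subrr; ring.
Qed.

(** The difference of the two sides has degree below [size s] and vanishes at all points of [s]. *)
Lemma lagrange_del_root s q : uniq s -> (size q <= size s)%N ->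
  q = \sum_(a <- s) (q.[a] / (del_root s a).[a]) *: del_root s a.
Proof.
move=> us sq; apply/eqP; rewrite -subr_eq0; apply/eqP.
apply: (@roots_geq_poly_eq0 _ _ s) => //.
  apply/allP => x xs; rewrite rootE hornerD hornerN horner_sum.
  rewrite (bigD1_seq x) //= big1_seq ?addr0 => [|a /andP[ax as_]].
    rewrite hornerZ divfK ?subrr //.
    by rewrite -[_ == 0]/(root _ x) root_del_root eqxx andbF.
  have := root_del_root s a x; rewrite xs eq_sym ax => /rootP e.
  by rewrite hornerZ e mulr0.
have size_del a : a \in s -> (size (del_root s a) <= size s)%N.
  move=> as_; rewrite /del_root -big_filter size_prod_XsubC size_filter.
  rewrite -(count_predC (pred1 a) s) -[X in (X < _)%N]add0n ltn_add2r.
  by rewrite -has_count has_pred1.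
rewrite (leq_trans (size_polyD _ _)) // geq_max sq size_polyN.
apply: (leq_trans (size_sum _ _ _)); apply/bigmax_leqP_seq => a as_ _.
exact: leq_trans (size_scale_leq _ _) (size_del _ as_).
Qed.

(** By linearity in [q] it suffices to take one interpolation term: if p = (x - a) l, then p' l - p
    l' = l^2. *)
Lemma wronskian_del_root s q : uniq s -> (size q <= size s)%N ->
  wronskian (\prod_(a <- s) ('X - a%:P)) q =
  \sum_(a <- s) (q.[a] / (del_root s a).[a]) *: del_root s a ^+ 2.
Proof.
move=> us sq; rewrite {1}(lagrange_del_root us sq) /wronskian raddf_sum /=.
rewrite !mulr_sumr -sumrB; apply: eq_big_seq => a as_.
rewrite derivZ (del_rootE us as_) derivM derivXsubC -!mul_polyC; ring.
Qed.

End Signs.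
(** Multiplying the sum by one weight makes all weights positive, so no cancellation can occur. The
    general [numDomainType] serves both real evaluation points and nonreal ones. *)
Lemma weighted_sum_neq0 (C : numDomainType) (I : eqType) (s : seq I)
    (w f : I -> C) :
  {in s &, forall a b, 0 < w a * w b} -> {in s, forall a, 0 <= f a} ->
  (exists2 a, a \in s & f a != 0) -> \sum_(a <- s) w a * f a != 0.
Proof.
move=> w_gt0 f_ge0 [a as_ fa]; apply/negP => /eqP sum0.
have : \sum_(b <- s | b \in s) (w a * w b) * f b == 0.
  rewrite -big_seq; under eq_bigr do rewrite -mulrA.
  by rewrite -mulr_sumr sum0 mulr0.
rewrite psumr_eq0 => [/allP/(_ a as_)|b bs].
  by rewrite as_ mulf_eq0 (negbTE fa) orbF gt_eqF ?w_gt0.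
by rewrite mulr_ge0 ?f_ge0 // ltW ?w_gt0.
Qed.

(** * Interlacing of complex polynomials with real coefficients *)

Section Interlacing.
Variable R : realType.
Implicit Types (p q : {poly R}) (P Q : {poly R[i]}) (a b c x : R) (z : R[i]).

Local Notation toC := (map_poly (real_complex R)).

Lemma root_toC p x : root (toC p) (real_complex R x) = root p x.
Proof. exact: fmorph_root. Qed.

Lemma ltcR a b : (real_complex R a < real_complex R b) = (a < b).
Proof. by rewrite ltcE eqxx. Qed.

(** The order on [R[i]] compares only numbers with equal imaginary parts, so its intervals with real
    endpoints are real. *)
Lemma itv_real a b z : real_complex R a < z < real_complex R b ->
  exists2 c, z = real_complex R c & a < c < b.
Proof.
case: z => x y /andP[]; rewrite !ltcE /= => /andP[/eqP -> ax] /andP[_ xb].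
by exists x; rewrite ?ax.
Qed.

Lemma real_rooted_real_root p z : real_rooted (toC p) -> root (toC p) z ->
  exists2 x, z = real_complex R x & root p x.
Proof.
move=> rp rz; have /complex_realP [x ex] := rp z rz.
by exists x => //; rewrite -root_toC -ex.
Qed.

Lemma real_poly_toC p : real_poly (toC p).
Proof. by move=> i; rewrite coef_map; apply/complex_realP; exists p`_i. Qed.

Lemma real_rooted_splits P : P \is monic -> real_rooted P ->
  exists s : seq R, P = toC (\prod_(a <- s) ('X - a%:P)).
Proof.
move=> /eqP mP rP; have [zs eP] := closed_field_poly_normal P.
move: eP; rewrite mP scale1r => eP.
exists [seq complex.Re z | z <- zs]; rewrite big_map rmorph_prod eP /=.
apply: eq_big_seq => z zs_.
have /complex_realP [x ->] : z \is Num.real by apply: rP;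
  rewrite eP root_prod_XsubC.
by rewrite map_polyXsubC.
Qed.

Lemma deriv_toC p x : (toC p)^`().[real_complex R x] = real_complex R p^`().[x].
Proof. by rewrite deriv_map horner_map. Qed.

(** Existence is [wronskian_root_between]. For uniqueness, two zeros of [q] would by the same lemma,
    with the roles exchanged, enclose a zero of [p] between consecutive zeros of [p]. *)
Lemma separates_wronskian p q : p != 0 -> q != 0 ->
  (forall x, (wronskian p q).[x] != 0) ->
  real_rooted (toC p) -> real_rooted (toC q) -> separates (toC q) (toC p).
Proof.
move=> p0 q0 W rp rq z1 z2 [lt12 r1 r2 nr].
have [a ea ra] := real_rooted_real_root rp r1.
have [b eb rb] := real_rooted_real_root rp r2.
move: lt12 nr; rewrite {}ea {}eb {z1 z2 r1 r2} ltcR => ab nr.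
have [c /andP[ac cb] rc] := wronskian_root_between p0 W ab ra rb.
have W' x : (wronskian q p).[x] != 0 by rewrite wronskianC hornerN oppr_eq0.
have no_two e e' : a < e -> e' < b -> root q e -> root q e' -> ~~ (e < e').
  move=> ae eb re re'; apply/negP => ee'.
  have [x /andP[ex xe] rx] := wronskian_root_between q0 W' ee' re re'.
  have := nr (real_complex R x); rewrite !ltcR root_toC rx.
  by rewrite (lt_trans ae) ?(lt_trans xe) // => /(_ isT).
exists (real_complex R c); split; first by rewrite !ltcR ac cb root_toC.
move=> z [/itv_real [e -> /andP[ae eb]]]; rewrite root_toC => re.
have [ce|ec|-> //] := ltgtP c e.
- by case/negP: (no_two c e ac eb rc re).
- by case/negP: (no_two e c ae cb re rc).
Qed.

(** A multiple zero of either polynomial, or a common zero, would be a zero of the Wronskian. *)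
Lemma interlace_wronskian p q : p != 0 -> q != 0 ->
  (forall x, (wronskian p q).[x] != 0) ->
  real_rooted (toC p) -> real_rooted (toC q) -> interlace (toC p) (toC q).
Proof.
move=> p0 q0 W rp rq.
have W' x : (wronskian q p).[x] != 0 by rewrite wronskianC hornerN oppr_eq0.
have simple p' q' : p' != 0 -> (forall x, (wronskian p' q').[x] != 0) ->
    real_rooted (toC p') -> forall z, root (toC p') z -> mup z (toC p') = 1%N.
  move=> p'0 Wp rp' z rz; apply/eqP.
  rewrite mup_deriv_eq1 ?map_poly_eq0 //.
  have [x ex rx] := real_rooted_real_root rp' rz.
  rewrite ex deriv_toC fmorph_eq0; apply: contra (Wp x) => /eqP dx.
  by rewrite /wronskian hornerD hornerN !hornerM dx (rootP rx) !mul0r subr0.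
split; first by split; rewrite ?map_poly_eq0 //; apply: real_poly_toC.
- by [].
- by split; [apply: (simple p q) | apply: (simple q p)].
- move=> z; apply/negP => /andP[rz];
  have [x -> rx] := real_rooted_real_root rp rz.
  rewrite root_toC => rqx; apply/negP: (W x); rewrite negbK.
  by rewrite /wronskian hornerD hornerN !hornerM (rootP rx) (rootP rqx) mul0r
    mulr0 subr0.
- by split; apply: separates_wronskian.
Qed.

Lemma interlace_simple p q x : interlace (toC p) (toC q) ->
  root p x -> p^`().[x] != 0.
Proof.
move=> [[p0 _ _ _] _ [mp _] _ _]; rewrite -root_toC => rx.
have /eqP := mp _ rx; rewrite mup_deriv_eq1 // deriv_toC.
by rewrite fmorph_eq0.
Qed.

Lemma interlace_sym P Q : interlace P Q -> interlace Q P.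
Proof.
case=> [[p0 q0 rp rq] [rrp rrq] [mp mq] nc [s1 s2]]; split=> // z.
by rewrite andbC.
Qed.

(** Between consecutive zeros of [p], both p' and [q] change sign, so the product q p' has the same
    sign at both ends. *)
Lemma interlace_same_sign p q : interlace (toC p) (toC q) ->
  forall a b, root p a -> root p b ->
  0 < (q.[a] * p^`().[a]) * (q.[b] * p^`().[b]).
Proof.
move=> pq a b ra rb; have simp := fun x => @interlace_simple _ _ x pq.
have simq := fun x => @interlace_simple _ _ x (interlace_sym pq).
case: (pq) => [[p0 _ _ _] _ _ nc [sep _]].
have qN x : root p x -> ~~ root q x.
  by move=> rx; have := nc (real_complex R x); rewrite !root_toC rx.
rewrite map_poly_eq0 in p0.
have mem_roots x : (x \in rootsR p) = root p x.
  by rewrite -(roots_on_rootsR p0) in_itv.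
have sq_gt0 x : root p x -> 0 < (q.[x] * p^`().[x]) * (q.[x] * p^`().[x]).
  by move=> rx; rewrite -expr2 exprn_even_gt0 //= mulf_neq0 ?simp ?qN.
have chain x y : x \in rootsR p -> y \in rootsR p -> x < y ->
    0 < (q.[x] * p^`().[x]) * (q.[y] * p^`().[y]).
  move=> xs ys xy.
  (* The relation also records that its right end is a zero of [p]: transitivity divides by the
     square of q p' at the middle point, which is positive only at such a zero. *)
  suff [] : (y \in rootsR p) /\ 0 < (q.[x] * p^`().[x]) * (q.[y] * p^`().[y])
    by [].
  apply: (consecutive_chain (s := rootsR p) (T := fun x y => y \in rootsR p /\
    0 < (q.[x] * p^`().[x]) * (q.[y] * p^`().[y]))) xy => //.
    move=> {x y xs ys} x y z [ys xy] [zs yz]; split=> //.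
    move: ys; rewrite mem_roots => /sq_gt0 yy.
    by rewrite -(pmulr_rgt0 _ yy) mulrACA mulr_gt0 // mulrC.
  move=> {x y xs ys} x y xs ys xy nr; split=> //; move: xs ys;
    rewrite !mem_roots => rx ry.
  have cons : consecutive_zeros (toC p) (real_complex R x) (real_complex R y).
    split; rewrite ?ltcR ?root_toC // => _ /itv_real [c -> cin].
    by rewrite root_toC; apply: contraL cin; rewrite -mem_roots => /nr.
  have [z [[/itv_real [c -> cin]]]] := sep _ _ cons.
  rewrite root_toC => rc uc; rewrite mulrACA nmulr_rgt0.
    apply: deriv_consecutive_roots; rewrite ?simp // => t t_in.
    by apply: contraL t_in; rewrite -mem_roots => /nr.
  apply: (lt0_horner_simple_root cin);
    rewrite ?simq ?qN // => t /andP[xt ty] rt.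
  by apply/complexI/esym/uc; rewrite !ltcR xt ty root_toC.
have [ab|ba|->] := ltgtP a b.
- by rewrite chain ?mem_roots.
- by rewrite mulrC chain ?mem_roots.
- exact: sq_gt0.
Qed.

(** Simplicity of the zeros gives [uniq s]. The quotient q / p' differs from the product q p' by a
    positive square, so the signs come from [interlace_same_sign]. *)
Lemma interlace_del_root_same_sign (s : seq R) q :
  interlace (toC (\prod_(a <- s) ('X - a%:P))) (toC q) ->
  uniq s /\ {in s &, forall a b,
    0 < (q.[a] / (del_root s a).[a]) * (q.[b] / (del_root s b).[b])}.
Proof.
move=> pq; have us : uniq s.
  apply: count_mem_uniq => x; have [xs|/count_memPn //] := boolP (x \in s).
  rewrite -mu_prod_XsubC; apply/eqP; rewrite mup_deriv_eq1 ?root_prod_XsubC //.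
    by apply: interlace_simple pq _; rewrite root_prod_XsubC.
  exact/monic_neq0/monic_prod_XsubC.
split=> // a b as_ bs; set da := (del_root s a).[a];
  set db := (del_root s b).[b].
have da0 : da != 0 by rewrite /da -rootE root_del_root eqxx andbF.
have db0 : db != 0 by rewrite /db -rootE root_del_root eqxx andbF.
have /(_ a b) := interlace_same_sign pq; rewrite !root_prod_XsubC.
move=> /(_ as_ bs); rewrite !deriv_del_root // -/da -/db.
have -> : (q.[a] * da) * (q.[b] * db) =
    (q.[a] / da) * (q.[b] / db) * (da * db) ^+ 2 by field; rewrite da0 db0.
by rewrite pmulr_lgt0 // exprn_even_gt0 //= mulf_neq0.
Qed.

Lemma interlace_wronskian_neq0 (s : seq R) q x : q != 0 ->
  (size q <= size s)%N ->
    interlace (toC (\prod_(a <- s) ('X - a%:P))) (toC q) ->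
  (wronskian (\prod_(a <- s) ('X - a%:P)) q).[x] != 0.
Proof.
move=> q0 sq /interlace_del_root_same_sign [us ws].
rewrite wronskian_del_root // horner_sum.
under eq_bigr do rewrite hornerZ horner_exp.
apply: (weighted_sum_neq0 ws) => [a _|]; first exact: sqr_ge0.
(* A nonzero square is needed: if [x] is a zero, its own term is the one that survives; otherwise
   any term does, and [s] is nonempty because [q] is nonzero. *)
have [xs|xs] := boolP (x \in s).
  by exists x => //; rewrite expf_neq0 // -rootE root_del_root eqxx andbF.
case: s us ws sq xs => [_ _|a s _ _ _ xs].
  by rewrite leqn0 size_poly_eq0 (negbTE q0).
by exists a; rewrite ?mem_head // expf_neq0 // -rootE root_del_root (negbTE xs).
Qed.

(* If p + c q vanishes at a nonreal z, then q(z) conj(p(z)) is real; but its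
   imaginary part is -Im z times a sum of terms w_a |p(z) / (z - a)|^2 whose
   weights have the same sign. *)
Lemma interlace_pencil_real_rooted (s : seq R) q c : q != 0 ->
  (size q <= size s)%N ->
    interlace (toC (\prod_(a <- s) ('X - a%:P))) (toC q) ->
  real_rooted (toC (\prod_(a <- s) ('X - a%:P) + c *: q)).
Proof.
move=> q0 sq /interlace_del_root_same_sign [us ws] z; apply: contraTT => zNR.
set p := \prod_(a <- s) _.
have conjR x : (real_complex R x)^* = real_complex R x.
  by apply/CrealP/complex_realP; exists x.
pose d a := (toC (del_root s a)).[z].
pose w a := real_complex R (q.[a] / (del_root s a).[a]).
have d0 a : d a != 0.
  rewrite /d map_prod_XsubC horner_prod prodf_seq_neq0.
  apply/allP => b _; rewrite hornerXsubC subr_eq0.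
  by apply/implyP => _; apply: contraNneq zNR => ->; apply/complex_realP;
    exists b.
have pE a : a \in s -> (toC p).[z] = (z - real_complex R a) * d a.
  move=> as_.
  by rewrite /p (del_rootE us as_) rmorphM /= hornerM map_polyXsubC hornerXsubC.
have qE : (toC q).[z] = \sum_(a <- s) w a * d a.
  rewrite (lagrange_del_root us sq) raddf_sum horner_sum.
  by apply: eq_bigr => a _; rewrite /= map_polyZ hornerZ.
have key : (toC q).[z] * ((toC p).[z])^* - ((toC q).[z])^* * (toC p).[z]
   = (z^* - z) * \sum_(a <- s) w a * `|d a| ^+ 2.
  rewrite qE rmorph_sum mulr_suml [X in _ - X]mulr_suml -sumrB mulr_sumr.
  apply: eq_big_seq => a as_.
  by rewrite (pE a as_) !rmorphM rmorphB /= !conjR normCK; ring.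
apply/negP; rewrite rmorphD /= map_polyZ rootE hornerD hornerZ addr_eq0 =>
  /eqP pq.
have : (z^* - z) * \sum_(a <- s) w a * `|d a| ^+ 2 == 0.
  by rewrite -key pq rmorphN rmorphM /= conjR; apply/eqP; ring.
rewrite mulf_eq0 subr_eq0 -CrealE (negbTE zNR) /=; apply/negP.
apply: weighted_sum_neq0 => [a b as_ bs|a _|].
- by rewrite -rmorphM -(rmorph0 (real_complex R)) ltcR ws.
- by rewrite exprn_ge0.
have [a as_] : exists a, a \in s.
  case: (s) sq => [|a s' _]; last by exists a; rewrite mem_head.
  by rewrite leqn0 size_poly_eq0 (negbTE q0).
by exists a; rewrite ?expf_neq0 ?normr_eq0.
Qed.

End Interlacing.

(** * Multiple orthogonality after multiplying the functionals by x - z0 *)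

Section Christoffel.
Variables (R : realType) (s : nat) (nu : 'I_s -> functional R) (z0 : R).
Implicit Types (n : multi_index s) (j : 'I_s).

Local Notation nuhat := (fun i => christoffel z0 (nu i)).
Local Notation XsubZ := ('X - (real_complex R z0)%:P).

Lemma mi_size_succ n j : mi_size (mi_succ n j) = (mi_size n).+1.
Proof.
rewrite /mi_size /mi_succ big_split /= -addn1; congr (_ + _)%N.
by rewrite -(big_mkcond (fun i => i == j)) big_pred1_eq.
Qed.

(** Subtracting the multiple of [mop nu n] cancels the coefficient of degree |n|; by normality the
    difference must then be zero. *)
Lemma type_II_cond_mop n P : normal nu n -> type_II_cond nu n P ->
  P = P`_(mi_size n) *: mop nu n.
Proof.
move=> nor [sP oP]; have [mQ sQ [_ oQ]] := mopP nor.
apply/eqP; rewrite -subr_eq0; apply/negPn/negP => D0.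
suff sD : (size (P - P`_(mi_size n) *: mop nu n)%R <= mi_size n)%N.
  suff : type_II_cond nu n (P - P`_(mi_size n) *: mop nu n).
    by move=> /(nor _ D0) e; rewrite e ltnn in sD.
  split=> [|i p ip]; first exact: leqW.
  by rewrite mulrBl -scalerAl linearB linearZ /= oP // oQ // mulr0 subr0.
apply/leq_sizeP => i; rewrite leq_eqVlt coefB coefZ => /predU1P[<-|lt_i].
  by move: mQ; rewrite monicE lead_coefE sQ => /eqP ->; rewrite mulr1 subrr.
rewrite [P`_i]nth_default ?(leq_trans sP) // [(mop nu n)`_i]nth_default ?sQ //.
by rewrite mulr0 subr0.
Qed.

(** Otherwise dividing by x - z0 gives a nonzero polynomial orthogonal for [nuhat] at the same
    index, of degree one too small. *)
Lemma mop_succ_not_root n j : normal nuhat (mi_succ n j) ->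
  normal nu (mi_succ n j) ->
  ~~ root (mop nu (mi_succ n j)) (real_complex R z0).
Proof.
move=> norh /mopP [/monic_neq0 P0 sP [_ oP]].
apply/negP => /factor_theorem [Q eP]; move: P0 sP oP; rewrite {}eP => P0.
have Q0 : Q != 0 by apply: contraNneq P0 => ->; rewrite mul0r.
rewrite size_mul ?polyXsubC_eq0 // size_XsubC addn2 /= => -[sQ] oQ.
have /norh := Q0; rewrite sQ => nor.
suff /nor /eqP : type_II_cond nuhat (mi_succ n j) Q by rewrite ltn_eqF.
split=> [|i p ip]; first by rewrite sQ.
by rewrite /christoffel /= /christoffel_fun mulrA [_ * Q]mulrC oQ.
Qed.

Lemma christoffel_mop n j :
  normal nuhat n -> normal nu n -> normal nu (mi_succ n j) ->
  exists c, XsubZ * mop nuhat n = mop nu (mi_succ n j) + c *: mop nu n.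
Proof.
move=> /mopP[mH sH [_ oH]] nor /mopP[mP sP [_ oP]].
have [mQ sQ [_ oQ]] := mopP nor.
have sF : size (XsubZ * mop nuhat n) = (mi_size n).+2.
  by rewrite size_monicM ?monicXsubC ?monic_neq0 // size_XsubC sH.
have mF : XsubZ * mop nuhat n \is monic by rewrite monicMl ?monicXsubC.
rewrite mi_size_succ in sP.
set D := XsubZ * mop nuhat n - mop nu (mi_succ n j).
suff cD : type_II_cond nu n D.
  (* Both polynomials are monic of degree |n| + 1, so [D] has degree at most |n| and the constant is
     its coefficient there. *)
  by exists D`_(mi_size n);
    rewrite -(type_II_cond_mop nor cD) /D [RHS]addrC subrK.
split=> [|i p ip].
  apply/leq_sizeP => i; rewrite leq_eqVlt coefB => /predU1P[<-|lt_i].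
    move: mF mP; rewrite !monicE !lead_coefE sF sP /= => /eqP -> /eqP ->.
    by rewrite subrr.
  by rewrite !nth_default ?sF ?sP ?subrr.
rewrite mulrBl linearB /= oP ?(leq_trans ip) ?leq_addr // subr0 -mulrA.
exact: oH.
Qed.

End Christoffel.

(** * Conclusion: the pencil P + d Q with real nonzero d *)

Local Open Scope complex_scope.

Theorem corollary3p23 (R : realType) (r : nat) (hr : (2 <= r)%N)
    (nu : 'I_(r - 1) -> functional R) (K : 'I_(r - 1) -> option nat)
    (hnu : forall i, in_calL (K i) (nu i))
    (z0 : R)
    (hperf : perfect_on K nu)
    (hperf_hat : perfect_on K (fun i => christoffel z0 (nu i)))
    (j : 'I_(r - 1)) (k : multi_index (r - 1))
    (hk : in_box (box_pred K j) k)
    (hint : interlace (mop nu (mi_succ k j)) (mop nu k)) :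
  let Phat := mop (fun i => christoffel z0 (nu i)) k in
  [/\ real_rooted Phat,
      interlace (('X - z0%:C%:P) * Phat) (mop nu k)
    & interlace (('X - z0%:C%:P) * Phat) (mop nu (mi_succ k j))].
Proof.
move=> Phat.
have kj_box : in_box K (mi_succ k j).
  move=> i; have := hk i; rewrite /box_pred /mi_succ; have := hnu i.
  case: eqP => [->|_]; case: (K _) => //= m; last by rewrite addn0.
  (* Positivity of [m], from [in_calL], is what lets [predn] be undone. *)
  by case=> m_gt0 _ _; rewrite -ltnS prednK // addn1.
have k_box : in_box K k.
  move=> i; have := kj_box i; case: (K i) => // m; apply: leq_trans.
  exact: leq_addr.
have [mP sP _] := mopP (hperf _ kj_box).
have [mQ sQ _] := mopP (hperf _ k_box).
have Pz0 := mop_succ_not_root (hperf_hat _ kj_box) (hperf _ kj_box).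
have [d eF] := christoffel_mop (hperf_hat _ k_box) (hperf _ k_box) (hperf _
  kj_box).
have [_ [rrP rrQ] _ _ _] := hint.
have [s eP] := real_rooted_splits mP rrP.
have [t eQ] := real_rooted_splits mQ rrQ.
rewrite -/Phat in eF.
rewrite mi_size_succ in sP; rewrite eF.
(* Evaluation at [z0] gives P(z0) + d Q(z0) = 0. As P(z0) is nonzero, so is Q(z0), and d = - P(z0) /
   Q(z0) is real and nonzero. *)
have /eqP := congr1 (fun F => F.[z0%:C]) eF.
rewrite hornerM hornerXsubC subrr mul0r eq_sym hornerD hornerZ => e0.
have root_F : real_rooted (mop nu (mi_succ k j) + d *: mop nu k) ->
  real_rooted Phat.
  by rewrite -eF => rr z rz; apply: rr; rewrite rootM rz orbT.
move: hint rrP rrQ sP sQ Pz0 e0 root_F; rewrite {}eP {}eQ {mP mQ eF}.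
set p := \prod_(a <- s) _; set q := \prod_(a <- t) _.
move=> pq rrP rrQ sP sQ; rewrite !horner_map fmorph_root => pz0 /eqP e0.
have q0 : q != 0 by apply/monic_neq0/monic_prod_XsubC.
have p0 : p != 0 by apply/monic_neq0/monic_prod_XsubC.
have sqs : (size q <= size s)%N.
  by move: sP sQ; rewrite !size_map_poly !size_prod_XsubC => -[->] ->.
have qz0 : q.[z0] != 0.
  apply: contra pz0 => /eqP qz; move: e0; rewrite qz rmorph0 mulr0 addr0.
  by move/complexI/rootP.
pose c := - p.[z0] / q.[z0].
have dE : d = c%:C.
  apply: (mulIf (_ : (q.[z0])%:C != 0)); first by rewrite fmorph_eq0.
  by rewrite -rmorphM /= divfK // rmorphN; apply/eqP;
    rewrite -addr_eq0 addrC e0.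
have c0 : c != 0 by rewrite mulf_neq0 ?oppr_eq0 ?invr_eq0.
have FE : map_poly (real_complex R) p + d *: map_poly (real_complex R) q =
    map_poly (real_complex R) (p + c *: q).
  by rewrite rmorphD /= map_polyZ dE.
rewrite FE => root_F.
have W x : (wronskian p q).[x] != 0 by apply: interlace_wronskian_neq0.
have rrF : real_rooted (map_poly (real_complex R) (p + c *: q)).
  exact: interlace_pencil_real_rooted.
have F0 : p + c *: q != 0.
  apply: contraNneq (W z0) => F0; rewrite -(wronskianDZ p q c) F0.
  by rewrite /wronskian deriv0 !mul0r subr0 horner0.
split; first exact: root_F.
- by apply: interlace_wronskian => // x; rewrite wronskianDZ.
(* The Wronskian of p + c q with [p] is - c times that of [p] with [q]; here c must be nonzero. *)
- apply: interlace_wronskian => // x.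
  rewrite /wronskian derivD derivZ.
  rewrite (_ : _ - _ = - c *: wronskian p q) ?hornerZ ?mulf_neq0 ?oppr_eq0 //.
  by rewrite /wronskian -!mul_polyC polyCN; ring.
Qed.
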